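(* Let $W$ be a positive definite $n\times n$ matrix. If the system $$\dot{x}(t)=\sum_{j=0}^{m}A_{j}x(t-h_{j})$$ is exponentially stable, then, with $U$ its delay Lyapunov matrix associated with $W$, $$\left[U(\tau_j-\tau_i)\right]_{i,j=1}^r>0$$ for every natural number $r$ and all real numbers $\tau_1,\ldots,\tau_r$ with $0\leqslant\tau_1<\tau_2<\ldots<\tau_r\leqslant H$.
   Context: System: $A_0,\ldots,A_m$ are real constant $n\times n$ matrices, $h_0=0$, $h_1,\ldots,h_m>0$ are delays, $H=\max\{h_1,\ldots,h_m\}$, and at least one $A_k$ with $k\in\{1,\ldots,m\}$ is nonzero. For a piecewise continuous initial function $\varphi:[-H,0]\to\mathbb{R}^n$, the solution $x(t,\varphi)$, $t\geqslant -H$, is the function that is continuous on $[0,\infty)$, satisfies the system almost everywhere on $[0,\infty)$, and equals $\varphi$ on $[-H,0]$. Norms: $\|\cdot\|$ is the Euclidean norm (induced norm for matrices), $\|\varphi\|_H=\sup_{\theta\in[-H,0]}\|\varphi(\theta)\|$. Exponential stability: there exist $\gamma\geqslant 1$, $\sigma>0$ with $\|x(t,\varphi)\|\leqslant\gamma e^{-\sigma t}\|\varphi\|_H$ for all $t\geqslant 0$ and all piecewise continuous $\varphi$. Lyapunov condition: the system has no eigenvalues symmetric with respect to zero, i.e. there are no two roots $s_1,s_2$ (possibly equal) of $\det\left(sI_n-\sum_{j=0}^m e^{-sh_j}A_j\right)=0$ with $s_1+s_2=0$. It holds automatically if the system is exponentially stable. Delay Lyapunov matrix associated with a positive definite matrix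 $W$: the function $U:\mathbb{R}\to\mathbb{R}^{n\times n}$ such that (1) $U$ is continuous; (2) $U'(\tau)=\sum_{j=0}^mU(\tau-h_j)A_j$ for $\tau>0$; (3) $U(\tau)=U^T(-\tau)$ for $\tau\in\mathbb{R}$; (4) $\sum_{j=0}^m\left(U(-h_j)A_j+A_j^TU(h_j)\right)=-W$. Under the Lyapunov condition it exists and is unique. $[B_{ij}]_{i,j=1}^r$ denotes the square block matrix whose block in row $i$, column $j$ is $B_{ij}$; $B>0$ means that the symmetric matrix $B$ is positive definite. *)

(* Defs.v *)
From HB Require Import structures.
From mathcomp Require Import all_boot all_order all_algebra.
From mathcomp Require Import all_classical all_reals all_analysis.

Set Implicit Arguments.
Unset Strict Implicit.
Unset Printing Implicit Defensive.

Import Order.TTheory GRing.Theory Num.Theory.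
Import numFieldNormedType.Exports.

Local Open Scope classical_set_scope.
Local Open Scope ring_scope.

(* The library norm `|v| on 'cV[R]_n is the sup norm; the Euclidean one is
   defined here. The two give the same topology, so limits and derivatives are
   taken with the library structure. *)
Definition enorm (R : realType) (n : nat) (v : 'cV[R]_n) : R :=
  Num.sqrt (\sum_(i < n) v i ord0 ^+ 2).

Definition posdef (R : realType) (n : nat) (B : 'M[R]_n) : Prop :=
  B^T = B /\
  forall v : 'cV[R]_n, v != 0 -> 0 < (v^T *m B *m v) ord0 ord0.

(* Only the values of f on [a, b] matter: finitely many discontinuities, all
   of the first kind. *)
Definition piecewise_continuous (R : realType) (n : nat) (a b : R)
    (f : R -> 'cV[R]_n) : Prop :=
  [/\ exists s : seq R, forall t : R, a < t < b -> t \notin s ->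
        {for t, continuous f},
      forall t : R, a <= t < b -> cvg (f @ t^'+) &
      forall t : R, a < t <= b -> cvg (f @ t^'-)].

Definition absolutely_continuous (R : realType) (n : nat) (a b : R)
    (f : R -> 'cV[R]_n) : Prop :=
  forall eps : R, 0 < eps -> exists2 delta : R, 0 < delta &
    forall (k : nat) (u v : 'I_k -> R),
      (forall i, a <= u i /\ u i <= v i /\ v i <= b) ->
      trivIset [set: 'I_k] (fun i => `]u i, v i[%classic) ->
      \sum_(i < k) (v i - u i) < delta ->
      \sum_(i < k) enorm (f (v i) - f (u i)) < eps.

(* h is meant to satisfy h ord0 = 0 < h k for all k != ord0, so that the
   default value 0 plays no role as soon as 0 < m. *)
Definition max_delay (R : realType) (m : nat) (h : 'I_m.+1 -> R) : R :=
  \big[Num.max/0]_(k < m.+1 | k != ord0) h k.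

(* ||phi||_H; the supremum is that of a bounded nonempty set when phi is
   piecewise continuous on [-H, 0] and 0 <= H. *)
Definition sup_enorm (R : realType) (n : nat) (H : R) (phi : R -> 'cV[R]_n)
    : R :=
  sup [set enorm (phi theta) | theta in `[- H, 0]].

(* x is the solution, on [-H, oo), with initial function phi. As usual for
   solutions in the almost-everywhere sense, continuity on [0, oo) is local
   absolute continuity: with mere continuity, solutions would not be unique
   (one could add Cantor-type functions). Values before -H are irrelevant. *)
Definition is_solution (R : realType) (n m : nat) (A : 'I_m.+1 -> 'M[R]_n)
    (h : 'I_m.+1 -> R) (phi x : R -> 'cV[R]_n) : Prop :=
  [/\ forall theta : R, - max_delay h <= theta <= 0 -> x theta = phi theta,
      {within `[0, +oo[, continuous x},
      forall T : R, 0 < T -> absolutely_continuous 0 T x &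
      {ae (@lebesgue_measure R), forall t : R, 0 <= t ->
        is_derive t 1 x (\sum_(j < m.+1) A j *m x (t - h j))}].

Definition exponentially_stable (R : realType) (n m : nat)
    (A : 'I_m.+1 -> 'M[R]_n) (h : 'I_m.+1 -> R) : Prop :=
  exists gamma sigma : R, [/\ 1 <= gamma, 0 < sigma &
    forall phi x : R -> 'cV[R]_n,
      piecewise_continuous (- max_delay h) 0 phi ->
      is_solution A h phi x ->
      forall t : R, 0 <= t ->
        enorm (x t) <=
          gamma * expR (- sigma * t) * sup_enorm (max_delay h) phi].

Definition is_delay_lyapunov_matrix (R : realType) (n m : nat)
    (A : 'I_m.+1 -> 'M[R]_n) (h : 'I_m.+1 -> R) (W : 'M[R]_n)
    (U : R -> 'M[R]_n) : Prop :=
  [/\ continuous U,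
      forall tau : R, 0 < tau ->
        is_derive tau 1 U (\sum_(j < m.+1) U (tau - h j) *m A j),
      forall tau : R, U tau = (U (- tau))^T &
      \sum_(j < m.+1) (U (- h j) *m A j + (A j)^T *m U (h j)) = - W].

(* Main.v *)
Require Import Defs.
From mathcomp Require Import all_boot all_order all_algebra.
From mathcomp Require Import all_classical all_reals all_analysis.
From mathcomp Require Import ring lra.

(** Let X be the fundamental matrix of the system, extended by 0 to negative
    times. Formally U(t) = \int_0^oo X(s)^T W X(s + t) ds, so that the block
    quadratic form at (g_i) is the integral of x^T W x, where
    x(t) = \sum_j X(t + tau_j) g_j. Since tau_1 < ... < tau_r, the function x is
    close to g_i just after -tau_i for the last i with g_i <> 0, whence
    positivity.

    Neither the existence of X nor that integral formula is needed. The
    matrix -W^-1 \sum_j (U(t - h_j) A_j + A_j^T U(t + h_j)) is the identity at 0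
    and solves the equation of X for t > 0, first with the A_j on the right,
    then, by uniqueness for a delay equation, with the A_j on the left;
    exponential stability makes it decay. With u(t) = \sum_j U(t + tau_j) g_j,
    the functional x^T u + \sum_k \int_(t - h_k)^t x^T A_k^T u(. + h_k) has
    derivative -x^T W x off a finite set, jumps at the points -tau_i by amounts
    whose sum is the quadratic form, vanishes before -H, and tends to 0 at
    infinity because U is bounded. *)

Import Order.TTheory GRing.Theory Num.Theory.
Import numFieldNormedType.Exports.

Set Implicit Arguments.
Unset Strict Implicit.
Unset Printing Implicit Defensive.

Local Open Scope ring_scope.

(** * Entrywise and algebraic rules for derivatives of matrix functions *)

Lemma is_derive_mxP (R : realType) (m n : nat) (M : R -> 'M[R]_(m, n)) (t : R) dM :
  is_derive t 1 M dM <->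
  forall i j, is_derive t 1 (fun x => M x i j : R) (dM i j).
Proof.
split=> [[dv eqd] i j|dij].
  split; first exact: (derivable_mxP M t 1).1.
  by rewrite -eqd derive_mx// mxE.
have dv : derivable M t 1 by apply/derivable_mxP => i j; have [] := dij i j.
split=> //; rewrite derive_mx//; apply/matrixP => i j; rewrite mxE.
by have [] := dij i j.
Qed.

Lemma is_derive_sumf (R : realType) (V : normedModType R) (k : nat)
    (F : 'I_k -> R -> V) (t : R) dF :
  (forall i, is_derive t 1 (F i) (dF i)) ->
  is_derive t 1 (fun x => \sum_(i < k) F i x) (\sum_(i < k) dF i).
Proof.
move=> dFi; have -> : (fun x => \sum_(i < k) F i x) = \sum_(i < k) F i.
  by apply/funext => x; rewrite fct_sumE.
exact: is_derive_sum.
Qed.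

Lemma is_derive_mulf (R : realType) (f g : R -> R) (t : R) df dg :
  is_derive t 1 f df -> is_derive t 1 g dg ->
  is_derive t 1 (fun x => f x * g x) (df * g t + f t * dg).
Proof.
move=> Df Dg; apply: (is_derive_eq (is_deriveM Df Dg)).
by rewrite addrC mulrC.
Qed.

Lemma is_derive_mulmx (R : realType) (m n p : nat) (M : R -> 'M[R]_(m, n))
    (N : R -> 'M[R]_(n, p)) (t : R) dM dN :
  is_derive t 1 M dM -> is_derive t 1 N dN ->
  is_derive t 1 (fun x => M x *m N x) (dM *m N t + M t *m dN).
Proof.
move=> /is_derive_mxP DM /is_derive_mxP DN; apply/is_derive_mxP => i j.
rewrite !mxE -big_split /=; have -> : (fun x => (M x *m N x) i j) =
    (fun x => \sum_k M x i k * N x k j) by apply/funext => x; rewrite mxE.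
by apply: is_derive_sumf => k; exact: is_derive_mulf.
Qed.

Lemma is_derive_mulmxl (R : realType) (m n p : nat) (B : 'M[R]_(m, n))
    (N : R -> 'M[R]_(n, p)) (t : R) dN :
  is_derive t 1 N dN -> is_derive t 1 (fun x => B *m N x) (B *m dN).
Proof.
move=> DN; have DB : is_derive t (1 : R) (cst B) 0 by exact: is_derive_cst.
by have := is_derive_mulmx DB DN; rewrite mul0mx add0r.
Qed.

Lemma is_derive_mulmxr (R : realType) (m n p : nat) (B : 'M[R]_(n, p))
    (M : R -> 'M[R]_(m, n)) (t : R) dM :
  is_derive t 1 M dM -> is_derive t 1 (fun x => M x *m B) (dM *m B).
Proof.
move=> DM; have DB : is_derive t (1 : R) (cst B) 0 by exact: is_derive_cst.
by have := is_derive_mulmx DM DB; rewrite mulmx0 addr0.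
Qed.

Lemma is_derive_trmx (R : realType) (m n : nat) (M : R -> 'M[R]_(m, n)) (t : R) dM :
  is_derive t 1 M dM -> is_derive t 1 (fun x => (M x)^T) dM^T.
Proof.
move=> /is_derive_mxP DM; apply/is_derive_mxP => i j; rewrite mxE.
by have := DM j i; congr is_derive; apply/funext => x; rewrite mxE.
Qed.

Lemma is_derive_shiftD (R : realType) (V : normedModType R) (f : R -> V) (t c : R) d :
  is_derive (t + c) 1 f d -> is_derive t 1 (fun x => f (x + c)) d.
Proof.
move=> [df <-]; rewrite /derive.
have E : (fun h : R => h^-1 *: (f (h *: 1 + (t + c)) - f (t + c))) =
         (fun h : R => h^-1 *: (f (h *: 1 + t + c) - f (t + c))).
  by apply/funext => h; rewrite addrA.
by split; [move: df|]; rewrite /derivable /derive/= E.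
Qed.

Lemma is_derive_reflect (R : realType) (m n : nat) (M : R -> 'M[R]_(m, n)) (t : R) dM :
  is_derive (- t) 1 M dM -> is_derive t 1 (fun x => M (- x)) (- dM).
Proof.
move=> /is_derive_mxP DM; apply/is_derive_mxP => i j; rewrite mxE.
have D1 : is_derive t (1 : R) (-%R : R -> R) (- 1) by exact: is_deriveNid.
by apply: (is_derive_eq (is_derive1_comp (DM i j) D1)); rewrite mulrN1.
Qed.

Local Open Scope classical_set_scope.

(** * Continuity of matrix functions *)

Lemma continuous_mxP (R : realType) (T : topologicalType) (m n : nat)
    (M : T -> 'M[R]_(m, n)) :
  continuous M <-> forall i j, continuous (fun x => M x i j : R).
Proof.
split=> [cM i j x|cM x].
  apply: (@continuous_comp _ _ _ M (fun N : 'M[R]_(m, n) => N i j) x (cM x));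
  exact: coord_continuous.
apply/cvgrPdist_le => /= e e0; near=> y.
rewrite [leLHS]/Num.Def.normr/= mx_normrE (bigmax_le _ (ltW e0))//= => i _.
rewrite !mxE; move: i; near: y; apply: filter_forall => /= i.
exact: ((cvgrPdist_le _ _).1 (cM i.1 i.2 x)).
Unshelve. all: by end_near. Qed.

Lemma continuous_sumf (R : realType) (T : topologicalType)
    (V : normedModType R) (k : nat) (F : 'I_k -> T -> V) :
  (forall i, continuous (F i)) -> continuous (fun x => \sum_(i < k) F i x).
Proof.
by move=> cF; apply: continuous_big => // x; exact: add_continuous.
Qed.

Lemma continuous_mulmx (R : realType) (T : topologicalType) (m n p : nat)
    (M : T -> 'M[R]_(m, n)) (N : T -> 'M[R]_(n, p)) :
  continuous M -> continuous N -> continuous (fun x => M x *m N x).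
Proof.
move=> /continuous_mxP cM /continuous_mxP cN; apply/continuous_mxP => i j.
have -> : (fun x => (M x *m N x) i j) = (fun x => \sum_k M x i k * N x k j).
  by apply/funext => x; rewrite mxE.
apply: continuous_sumf => k x; apply: cvgM; [exact: cM|exact: cN].
Qed.

Lemma continuous_trmx (R : realType) (T : topologicalType) (m n : nat)
    (M : T -> 'M[R]_(m, n)) :
  continuous M -> continuous (fun x => (M x)^T).
Proof.
move=> /continuous_mxP cM; apply/continuous_mxP => i j.
by have -> : (fun x => (M x)^T i j) = (fun x => M x j i);
  [apply/funext => x; rewrite mxE|exact: cM].
Qed.

Lemma continuous_addr (R : realType) (c : R) : continuous (fun x : R => x + c).
Proof. by move=> x; apply: cvgD; [exact: cvg_id|exact: cvg_cst]. Qed.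

Lemma continuous_max0 (R : realType) : continuous (fun x : R => Num.max x 0).
Proof.
by move=> x; apply: (@continuous_max R R id (cst 0)) ; [exact: cvg_id|exact: cvg_cst].
Qed.

Lemma continuous_addf (R : realType) (T : topologicalType)
    (V : normedModType R) (f g : T -> V) :
  continuous f -> continuous g -> continuous (fun x => f x + g x).
Proof. by move=> cf cg x; apply: cvgD; [exact: cf|exact: cg]. Qed.

Lemma continuous_oppf (R : realType) (T : topologicalType)
    (V : normedModType R) (f : T -> V) :
  continuous f -> continuous (fun x => - f x).
Proof. by move=> cf x; apply: cvgN; exact: cf. Qed.

Lemma continuous_mulmxl (R : realType) (T : topologicalType) (m n p : nat)
    (M : 'M[R]_(m, n)) (N : T -> 'M[R]_(n, p)) :
  continuous N -> continuous (fun x => M *m N x).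
Proof. by move=> cN; apply: continuous_mulmx => // x; exact: cvg_cst. Qed.

Lemma continuous_mulmxr (R : realType) (T : topologicalType) (m n p : nat)
    (M : T -> 'M[R]_(m, n)) (N : 'M[R]_(n, p)) :
  continuous M -> continuous (fun x => M x *m N).
Proof. by move=> cM; apply: continuous_mulmx => // x; exact: cvg_cst. Qed.

Lemma continuous_compf (T1 T2 T3 : topologicalType) (f : T1 -> T2) (g : T2 -> T3) :
  continuous f -> continuous g -> continuous (fun x => g (f x)).
Proof. by move=> cf cg x; exact: (@continuous_comp _ _ _ f g x (cf x) (cg _)). Qed.

(** * Mean value inequalities with finitely many exceptional points *)

Section FiniteExceptions.
Variable R : realType.
Implicit Types (S : seq R) (f g dg : R -> R).

(** Induction on the list of exceptions: one that lies inside the interval splits it in two, one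
    outside is dropped. With no exception left, this is the mean value theorem. *)
Lemma derive_le0_decr S f (a b : R) : continuous f -> a <= b ->
  (forall t : R, a < t < b -> t \notin S -> exists2 d, d <= 0 & is_derive t 1 f d) ->
  f b <= f a.
Proof.
move=> cf; elim: S a b => [|s S IH] a b ab df.
  have cab : {within `[a, b], continuous f} by exact: continuous_subspaceT.
  have Df t : t \in `]a, b[%R -> is_derive t 1 f ('D_1 f t).
    by rewrite in_itv /= => /df-/(_ isT) [d _ [? _]]; apply: derivableP.
  have [le_ab|] := ltP a b; last first.
    by move=> ba; have -> : a = b by apply/le_anti; rewrite ab ba.
  have [c cab' E] := MVT le_ab Df cab.
  rewrite -subr_le0 E; apply: mulr_le0_ge0; last by rewrite subr_ge0.
  move: cab'; rewrite in_itv /= => /df-/(_ isT) [d d0 [_ ->]]; exact: d0.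
have [/andP[a_s s_b]|sab] := boolP (a < s < b).
  apply: (@le_trans _ _ (f s)); apply: IH; rewrite ?ltW// => t /andP[at_ tb] tS.
    apply: df; first by rewrite tb (lt_trans a_s at_).
    by rewrite in_cons negb_or tS gt_eqF.
  apply: df; first by rewrite at_ (lt_trans tb s_b).
  by rewrite in_cons negb_or tS lt_eqF.
apply: IH => // t tab tS; apply: df => //.
by rewrite in_cons negb_or tS andbT; apply: contraNneq sab => <-.
Qed.

(** Both f - g and - f - g have nonpositive derivative, hence decrease. *)
Lemma derive_dominated S f g dg (a b : R) : continuous f -> continuous g ->
  a <= b -> (forall t : R, is_derive t 1 g (dg t)) ->
  (forall t : R, a < t < b -> t \notin S ->
     exists2 d, `|d| <= dg t & is_derive t 1 f d) ->
  `|f b - f a| <= g b - g a.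
Proof.
move=> cf cg ab Dg Df.
have H1 : f b - g b <= f a - g a.
  apply: (@derive_le0_decr S (fun x => f x - g x)) => // [x|t tab tS].
    by apply: cvgB; [exact: cf|exact: cg].
  have [d dle Dd] := Df t tab tS; exists (d - dg t).
    by rewrite subr_le0 (le_trans (ler_norm _)).
  exact: is_deriveB.
have H2 : - f b - g b <= - f a - g a.
  apply: (@derive_le0_decr S (fun x => - f x - g x)) => // [x|t tab tS].
    by apply: cvgB; [apply: cvgN; exact: cf|exact: cg].
  have [d dle Dd] := Df t tab tS; exists (- d - dg t).
    by rewrite subr_le0 (le_trans (ler_norm _))// normrN.
  by apply: is_deriveB; exact: is_deriveN.
rewrite ler_norml; apply/andP; split; lra.
Qed.

Lemma derive_bounded S f (L a b : R) : continuous f -> a <= b ->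
  (forall t : R, a < t < b -> t \notin S ->
     exists2 d, `|d| <= L & is_derive t 1 f d) ->
  `|f b - f a| <= L * (b - a).
Proof.
move=> cf ab Df; rewrite mulrBr.
apply: (@derive_dominated S f ( *%R L) (cst L)) => // [x|t].
  by apply: cvgMl_tmp; exact: cvg_id.
by have := @is_deriveZ R _ _ id L t 1 1 (is_derive_id _ _); rewrite /GRing.scale /= mulr1.
Qed.

Lemma derive0_cst S f (a b : R) : continuous f -> a <= b ->
  (forall t : R, a < t < b -> t \notin S -> is_derive t 1 f 0) ->
  f b = f a.
Proof.
move=> cf ab Df; apply/eqP; rewrite -subr_eq0 -normr_le0.
rewrite -(mul0r (b - a)); apply: (derive_bounded (S := S)) => // t tab tS.
by exists 0; [rewrite normr0|exact: Df].
Qed.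

(** The integral starts at a, so the derivative is claimed only to the right of a. The upper end x +
    1 makes x an interior point. *)
Lemma continuous_primitive f (a : R) : continuous f ->
  exists F : R -> R, forall x, a < x -> is_derive x 1 F (f x).
Proof.
move=> cf; exists (fun x => \int[lebesgue_measure]_(t in `[a, x]) f t)%R => x ax.
have [||||d1 d2] := @continuous_FTC1_closed R f a x (x + 1) => //.
- by rewrite ltrDl.
- apply: continuous_compact_integrable; first exact: segment_compact.
  exact: continuous_subspaceT.
- exact: cf.
by split; [exact: d1|rewrite -derive1E].
Qed.

End FiniteExceptions.

(** * Comparison of the sup norm, the Euclidean norm and matrix products *)

Section Norms.
Variable R : realType.

Lemma mx_entry_le (m n : nat) (M : 'M[R]_(m, n)) i j : `|M i j| <= `|M|.
Proof.
rewrite [leRHS]/Num.Def.normr/= mx_normrE.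
exact: (le_bigmax _ (fun ij : 'I_m * 'I_n => `|M ij.1 ij.2|) (i, j)).
Qed.

Lemma mx_norm_le (m n : nat) (M : 'M[R]_(m, n)) (c : R) : 0 <= c ->
  (forall i j, `|M i j| <= c) -> `|M| <= c.
Proof.
move=> c0 Mc; rewrite [leLHS]/Num.Def.normr/= mx_normrE.
by apply: bigmax_le => // i _; exact: Mc.
Qed.

Lemma mx_norm_mul (m n p : nat) (M : 'M[R]_(m, n)) (N : 'M[R]_(n, p)) :
  `|M *m N| <= n%:R * (`|M| * `|N|).
Proof.
apply: mx_norm_le => [|i j]; first by rewrite !mulr_ge0.
rewrite mxE (le_trans (ler_norm_sum _ _ _))//.
apply: (@le_trans _ _ (\sum_(k < n) `|M| * `|N|)).
  by apply: ler_sum => k _; rewrite normrM ler_pM// mx_entry_le.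
by rewrite sumr_const card_ord mulr_natl.
Qed.

Lemma mx_norm_tr (m n : nat) (M : 'M[R]_(m, n)) : `|M^T| = `|M|.
Proof.
apply/le_anti/andP; split; apply: mx_norm_le => // i j.
  by rewrite mxE mx_entry_le.
by have := mx_entry_le M^T j i; rewrite mxE.
Qed.

Lemma enorm_entry (n : nat) (v : 'cV[R]_n) i : `|v i ord0| <= enorm v.
Proof.
rewrite /enorm -sqrtr_sqr ler_wsqrtr// (bigD1 i)//= lerDl.
by apply: sumr_ge0 => k _; exact: sqr_ge0.
Qed.

Lemma norm_le_enorm (n : nat) (v : 'cV[R]_n) : `|v| <= enorm v.
Proof.
apply: mx_norm_le => [|i j]; first exact: sqrtr_ge0.
by rewrite (ord1 j) enorm_entry.
Qed.

Lemma enorm_le (n : nat) (v : 'cV[R]_n) : enorm v <= n%:R * `|v|.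
Proof.
rewrite -(@ger0_norm _ (n%:R * `|v|)) ?mulr_ge0// -sqrtr_sqr ler_wsqrtr//.
apply: (@le_trans _ _ (\sum_(i < n) `|v| ^+ 2)).
  apply: ler_sum => i _; rewrite -real_normK ?num_real// lerXn2r ?nnegrE//.
  exact: mx_entry_le.
rewrite sumr_const card_ord exprMn -[leLHS]mulr_natl ler_wpM2r ?sqr_ge0//.
by rewrite -natrX ler_nat; case: (n) => // k; rewrite leq_pmulr.
Qed.

End Norms.

Lemma posdef_unitmx (R : realType) (n : nat) (W : 'M[R]_n) :
  posdef W -> W \in unitmx.
Proof.
move=> [_ Wpos]; rewrite unitmxE unitfE; apply/det0P => -[v v0 vW].
have /Wpos : v^T != 0 by rewrite -(inj_eq trmx_inj) trmxK trmx0.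
by rewrite trmxK vW mul0mx mxE ltxx.
Qed.

(** * The fundamental matrix expressed through the Lyapunov matrix *)

Section Fundamental.
Variables (R : realType) (n m : nat) (A : 'I_m.+1 -> 'M[R]_n).
Variables (h : 'I_m.+1 -> R) (W : 'M[R]_n) (U : R -> 'M[R]_n).
Hypothesis h_ge0 : forall k, 0 <= h k.
Hypothesis W_posdef : posdef W.
Hypothesis U_lyap : is_delay_lyapunov_matrix A h W U.

Lemma U_tr t : U (- t) = (U t)^T.
Proof. by case: U_lyap => _ _ /(_ (- t)); rewrite opprK. Qed.

Lemma U_continuous : continuous U.
Proof. by case: U_lyap. Qed.

Lemma U_shift_continuous c : continuous (fun t => U (t + c)).
Proof.
by apply: (@continuous_compf _ _ _ (fun t => t + c) U);
  [exact: continuous_addr|exact: U_continuous].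
Qed.

Lemma U_derive_gt0 (t : R) : 0 < t ->
  is_derive t 1 U (\sum_j U (t - h j) *m A j).
Proof. by case: U_lyap => _ + _ _; apply. Qed.

(** Transposing the equation at - t by means of U(- t) = U(t)^T moves the coefficients to the left
    and turns delays into advances. *)
Lemma U_derive_lt0 (t : R) : t < 0 ->
  is_derive t 1 U (- \sum_j (A j)^T *m U (t + h j)).
Proof.
rewrite -oppr_gt0 => /U_derive_gt0/is_derive_trmx/is_derive_reflect D.
have EU : (fun x => (U (- x))^T) = U by apply/funext => x; rewrite U_tr trmxK.
rewrite EU in D; apply: (is_derive_eq D); rewrite linear_sum /=; congr (- _).
by apply: eq_bigr => j _; rewrite trmx_mul -U_tr opprB opprK addrC.
Qed.

(** For t > 0 this is U'(t) + \sum_j A_j^T U(t + h_j): it measures by how much U fails, at positive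
    times, the equation that it satisfies at negative ones. *)
Definition lyap_defect t := \sum_j (U (t - h j) *m A j + (A j)^T *m U (t + h j)).

Lemma lyap_defect0 : lyap_defect 0 = - W.
Proof.
case: U_lyap => _ _ _ <-; apply: eq_bigr => j _.
by rewrite sub0r add0r.
Qed.

Lemma lyap_defect_continuous : continuous lyap_defect.
Proof.
apply: continuous_sumf => j; apply: continuous_addf.
  exact/continuous_mulmxr/U_shift_continuous.
exact/continuous_mulmxl/U_shift_continuous.
Qed.

(** Each U(t - h_j) follows the equation for positive or for negative arguments according to the
    sign of t - h_j. In the first case the terms with right factor A_j add up to the defect at t -
    h_j, in the second they cancel. The delays are excluded because U may have a corner at 0. *)
Lemma lyap_defect_derive (t : R) : 0 < t -> t \notin codom h ->
  is_derive t 1 lyap_defect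
    (\sum_j if h j <= t then lyap_defect (t - h j) *m A j else 0).
Proof.
move=> t0 th.
pose D1 j := if h j <= t then \sum_k U (t - h j - h k) *m A k
             else - \sum_k (A k)^T *m U (t - h j + h k).
pose D2 j := \sum_k U (t + h j - h k) *m A k.
have D : is_derive t 1 lyap_defect (\sum_j (D1 j *m A j + (A j)^T *m D2 j)).
  apply: is_derive_sumf => j; apply: is_deriveD.
    apply: is_derive_mulmxr; apply: is_derive_shiftD; rewrite /D1.
    have [hjt|thj] := leP (h j) t; last by apply: U_derive_lt0; rewrite subr_lt0.
    apply: U_derive_gt0; rewrite subr_gt0 lt_neqAle hjt andbT.
    by apply: contraNneq th => <-; exact: codom_f.
  apply: is_derive_mulmxl; apply: is_derive_shiftD; apply: U_derive_gt0.
  by rewrite ltr_wpDr.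
apply: (is_derive_eq D); rewrite big_split /=.
(* Exchanging the two summations gathers the terms with A_j as right factor, ready to be combined
   with [D1 j]. *)
have -> : \sum_j (A j)^T *m D2 j =
    \sum_j (\sum_k (A k)^T *m U (t - h j + h k)) *m A j.
  rewrite /D2; under eq_bigr do rewrite mulmx_sumr.
  rewrite exchange_big; apply: eq_bigr => j _; rewrite mulmx_suml.
  by apply: eq_bigr => k _; rewrite mulmxA addrAC.
rewrite -big_split /=; apply: eq_bigr => j _; rewrite /D1 -mulmxDl.
by case: ifP => _; rewrite ?addNr ?mul0mx// -big_split.
Qed.

(** Continuous on the whole line, whereas [fund] jumps at 0 from 0 to the identity. Derivatives are
    therefore taken of [fund_ext], and delayed terms are written with [fund]. *)
Definition fund_ext t := - (invmx W *m lyap_defect t).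

Definition fund t := if 0 <= t then fund_ext t else 0.

Lemma fund_ge0 t : 0 <= t -> fund t = fund_ext t.
Proof. by rewrite /fund => ->. Qed.

Lemma fund_lt0 t : t < 0 -> fund t = 0.
Proof. by rewrite /fund leNgt => ->. Qed.

Lemma fund_ext0 : fund_ext 0 = 1%:M.
Proof. by rewrite /fund_ext lyap_defect0 mulmxN opprK mulVmx// posdef_unitmx. Qed.

Lemma fund_ext_continuous : continuous fund_ext.
Proof.
exact/continuous_oppf/continuous_mulmxl/lyap_defect_continuous.
Qed.

Lemma lyap_defectE t : 0 <= t -> lyap_defect t = - (W *m fund t).
Proof.
move=> t0; rewrite fund_ge0// mulmxN opprK mulmxA mulmxV ?mul1mx//.
exact: posdef_unitmx.
Qed.

Lemma fund_derive_r (t : R) : 0 < t -> t \notin codom h ->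
  is_derive t 1 fund_ext (\sum_j fund (t - h j) *m A j).
Proof.
move=> t0 th; have D := is_derive_mulmxl (invmx W) (lyap_defect_derive t0 th).
apply: (is_derive_eq (is_deriveN D)).
rewrite mulmx_sumr -sumrN; apply: eq_bigr => j _; rewrite /fund subr_ge0.
by case: ifP => _; rewrite ?mulmx0 ?oppr0 ?mul0mx// mulmxA mulNmx.
Qed.

(** One formula on both sides of 0: the equation for negative times, with a source term
    [W *m fund t] that switches on at 0. *)
Lemma U_derive (t : R) : t != 0 ->
  is_derive t 1 U (- (W *m fund t) - \sum_j (A j)^T *m U (t + h j)).
Proof.
rewrite neq_lt => /orP[t0|t0].
  by rewrite fund_lt0// mulmx0 oppr0 add0r; exact: U_derive_lt0.
apply: (is_derive_eq (U_derive_gt0 t0)); rewrite -lyap_defectE ?ltW//.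
by rewrite /lyap_defect big_split /= addrK.
Qed.

End Fundamental.

(** * Uniqueness for delay equations and the left equation of the fundamental matrix *)

(** Exponentially weighted norm: let f(t) = |E(t)| / exp(l t) be maximal on [0, T] at c. Integrating
    the equation from 0 to c gives f(c) <= f(c) / 2 once l is twice a bound C of the coefficients,
    so f(c) = 0. *)
Lemma delay_gronwall (R : realType) (m p q : nat) (h : 'I_m -> R)
    (B : 'I_m -> 'M[R]_q) (E : R -> 'M[R]_(p, q)) (S : seq R) :
  (forall k, 0 <= h k) -> continuous E -> (forall t, t <= 0 -> E t = 0) ->
  (forall t : R, 0 < t -> t \notin S ->
     is_derive t 1 E (\sum_j E (t - h j) *m B j)) ->
  forall t, E t = 0.
Proof.
move=> h_ge0 cE E0 DE T; have [/E0//|T0] := leP T 0.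
(* The summand 1 keeps C, and with it the rate l, positive even if all coefficients vanish. *)
pose C : R := \sum_j q%:R * `|B j| + 1.
have C0 : 0 < C by rewrite ltr_wpDl// sumr_ge0// => j _; rewrite mulr_ge0.
pose l := 2 * C; have l0 : 0 < l by rewrite mulr_gt0.
pose e (t : R) := expR (l * t).
have De (t : R) : is_derive t 1 e (l * e t).
  have Dl : is_derive t 1 ( *%R l) l.
    have := @is_deriveZ R _ _ id l t 1 1 (is_derive_id _ _).
    by rewrite /GRing.scale /= mulr1.
  by have := is_derive1_comp (is_derive_expR (l * t)) Dl; rewrite mulrC.
have ce : continuous e.
  by move=> t; apply/differentiable_continuous/derivable1_diffP; case: (De t).
have e_gt0 t : 0 < e t by exact: expR_gt0.
pose f t := `|E t| / e t.
have cf : continuous f.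
  move=> t; apply: cvgM; first by apply: cvg_norm; exact: cE.
  by apply: cvgV; [rewrite gt_eqF|exact: ce].
have [|c cT fc] := @EVT_max R f 0 T (ltW T0); first exact: continuous_subspaceT.
have Ef t : `|E t| = f t * e t by rewrite mulfVK// gt_eqF.
have fc0 : 0 <= f c by rewrite divr_ge0// ltW.
move: cT; rewrite in_itv /= => /andP[c0 cT].
(* The bound also covers the negative times that the delays reach, where E vanishes. *)
have Ebound t : t <= T -> `|E t| <= f c * e t.
  move=> tT; have [/E0 ->|t0] := leP t 0.
    by rewrite normr0 mulr_ge0// ltW.
  by rewrite Ef ler_wpM2r ?(ltW (e_gt0 _))// fc// in_itv /= tT ltW.
(* The derivative of g is f(c) C e(t), because l = 2 C; it dominates the derivative of each entry of
   E. *)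
pose g t := f c / 2 * e t.
have Ec : `|E c| <= f c / 2 * e c.
  apply: mx_norm_le => [|i j]; first by rewrite mulr_ge0 ?divr_ge0// ltW.
  have := @derive_dominated R S (fun t => E t i j) g (fun t => f c * C * e t) 0 c.
  rewrite [E 0]E0// mxE subr0 => /(_ _ _ c0) H.
  apply: le_trans (H _ _ _ _) _ => //.
  - by move/continuous_mxP : cE; apply.
  - by move=> t; apply: cvgMl_tmp; exact: ce.
  - move=> t; have := @is_deriveZ R _ _ e (f c / 2) t 1 _ (De t).
    by congr is_derive; rewrite /GRing.scale /= /l; field.
  - move=> t /andP[t0 tc] tS; exists ((\sum_j E (t - h j) *m B j) i j).
      rewrite (le_trans (mx_entry_le _ _ _))// (le_trans (ler_norm_sum _ _ _))//.
      rewrite (@le_trans _ _ (\sum_j (q%:R * `|B j|) * (f c * e t)))//.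
        apply: ler_sum => k _; rewrite (le_trans (mx_norm_mul _ _))//.
        rewrite -mulrA ler_wpM2l// [leLHS]mulrC ler_wpM2l//.
        rewrite (le_trans (Ebound _ _))//.
          by rewrite lerBlDr ler_wpDr// (le_trans (ltW tc)).
        rewrite ler_wpM2l// ler_expR ler_wpM2l ?(ltW l0)//.
        by rewrite gerDl oppr_le0.
      have -> : f c * C * e t = C * (f c * e t) by ring.
      rewrite -mulr_suml ler_wpM2r//.
        by rewrite mulr_ge0// ltW.
      by rewrite lerDl.
    by have /is_derive_mxP := DE t t0 tS; apply.
  - by rewrite /g lerBlDr lerDl mulr_ge0 ?divr_ge0// ltW.
have fc_le0 : f c <= 0.
  have : f c <= f c / 2 by rewrite {1}/f ler_pdivrMr.
  lra.
apply/eqP; rewrite -normr_le0 (le_trans (Ebound T _))//.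
by rewrite mulr_le0_ge0// ltW.
Qed.

Section LeftEquation.
Variables (R : realType) (n m : nat) (A : 'I_m.+1 -> 'M[R]_n).
Variables (h : 'I_m.+1 -> R) (W : 'M[R]_n) (U : R -> 'M[R]_n).
Hypothesis h_ge0 : forall k, 0 <= h k.
Hypothesis W_posdef : posdef W.
Hypothesis U_lyap : is_delay_lyapunov_matrix A h W U.
Local Notation X := (fund A h W U).
Local Notation X' := (fund_ext A h W U).

(* The commutator is written with the extension of the fundamental matrix:
   the jump of X at 0 is the identity, which commutes with every A j, so that
   this difference has no jump at the points h j. *)
Lemma fund_comm_sum t :
  \sum_j X (t - h j) *m A j = \sum_j A j *m X (t - h j).
Proof.
(* Freezing the argument at 0 makes Z constantly the identity at negative times, hence continuous
   everywhere. *)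
pose Z s := X' (Num.max s 0).
have cZ : continuous Z.
  by apply: continuous_compf; [exact: continuous_max0|exact: fund_ext_continuous].
have ZC s j : Z s *m A j - A j *m Z s = X s *m A j - A j *m X s.
  rewrite /Z; have [s0|s0] := leP s 0; last by rewrite fund_ge0// ltW.
  rewrite (fund_ext0 W_posdef U_lyap) mul1mx mulmx1 subrr.
  move: s0; rewrite le_eqVlt => /predU1P[->|s0].
    by rewrite fund_ge0// (fund_ext0 W_posdef U_lyap) mul1mx mulmx1 subrr.
  by rewrite fund_lt0// mul0mx mulmx0 subrr.
pose E s := \sum_j (Z (s - h j) *m A j - A j *m Z (s - h j)).
have EX s : E s = \sum_j X (s - h j) *m A j - \sum_j A j *m X (s - h j).
  by rewrite -sumrB; apply: eq_bigr => j _; rewrite ZC.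
suff E0 : E t = 0 by apply/eqP; rewrite -subr_eq0 -EX E0.
have cZs j : continuous (fun s => Z (s - h j)).
  by apply: (@continuous_compf _ _ _ (fun s => s - h j)); [exact: continuous_addr|].
(* Z(s - h_j) may fail to be differentiable when s - h_j is 0 or is itself a delay; these are the
   two kinds of exceptions. *)
pose S := codom h ++ codom (fun ij : 'I_m.+1 * 'I_m.+1 => h ij.1 + h ij.2).
apply: (@delay_gronwall R m.+1 n n h A E S h_ge0) => [|s s0|s s0 sS].
- apply: continuous_sumf => j; apply: continuous_addf.
    exact/continuous_mulmxr.
  exact/continuous_oppf/continuous_mulmxl.
- apply: big1 => j _; rewrite /Z max_r; last first.
    by rewrite subr_le0 (le_trans s0).
  by rewrite (fund_ext0 W_posdef U_lyap) mul1mx mulmx1 subrr.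
have sh j : s - h j != 0.
  rewrite subr_eq0; apply: contraNneq sS => ->.
  by rewrite mem_cat codom_f.
have DZ j : is_derive s 1 (fun s => Z (s - h j)) (\sum_k X (s - h j - h k) *m A k).
  have [sj|sj] := ltP (h j) s.
    have Zeq : \near s, X' (s - h j) = Z (s - h j).
      near=> u; rewrite /Z max_l// subr_ge0.
      by apply: ltW; near: u; exact: lt_nbhsr.
    apply: (near_eq_is_derive Zeq).
    apply: (is_derive_shiftD (f := X') (c := - h j)).
    apply: (fund_derive_r h_ge0 U_lyap).
      by rewrite subr_gt0.
    apply: contra sS => /codomP[k sk]; rewrite mem_cat; apply/orP; right.
    by apply/codomP; exists (j, k) => /=; rewrite -sk addrC subrK.
  have {}sj : s < h j by rewrite lt_neqAle sj andbT -subr_eq0.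
  have Zeq : \near s, 1%:M = Z (s - h j).
    near=> u; rewrite /Z max_r ?(fund_ext0 W_posdef U_lyap)// subr_le0.
    by apply: ltW; near: u; exact: lt_nbhsl.
  apply: (near_eq_is_derive Zeq).
  have -> : \sum_k X (s - h j - h k) *m A k = 0.
    apply: big1 => k _; rewrite fund_lt0 ?mul0mx// subr_lt0.
    by rewrite (@lt_le_trans _ _ 0)// subr_lt0.
  exact: is_derive_cst.
have DE : is_derive s 1 E (\sum_j ((\sum_k X (s - h j - h k) *m A k) *m A j -
    A j *m (\sum_k X (s - h j - h k) *m A k))).
  apply: is_derive_sumf => j; apply: is_deriveB.
    exact: is_derive_mulmxr.
  exact: is_derive_mulmxl.
(* Reordering the double sum in the second half lets A_j stand on the right of the commutator sum at
   s - h_j, so E solves a homogeneous delay equation. *)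
apply: (is_derive_eq DE); rewrite sumrB.
under [in RHS]eq_bigr do rewrite EX mulmxBl.
rewrite sumrB; congr (_ - _).
under eq_bigr do rewrite mulmx_sumr.
rewrite exchange_big; apply: eq_bigr => j _; rewrite mulmx_suml.
by apply: eq_bigr => k _; rewrite mulmxA addrAC.
Unshelve. all: by end_near. Qed.

Lemma fund_derive_l (t : R) : 0 < t -> t \notin codom h ->
  is_derive t 1 X' (\sum_j A j *m X (t - h j)).
Proof.
move=> t0 th; rewrite -fund_comm_sum.
exact: (fund_derive_r h_ge0 U_lyap).
Qed.

End LeftEquation.

(** * Exponential decay of the fundamental matrix *)

Lemma continuous_bounded_itv (R : realType) (m n : nat) (f : R -> 'M[R]_(m, n))
    (a b : R) : continuous f ->
  exists2 C : R, 0 <= C & forall t, a <= t <= b -> `|f t| <= C.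
Proof.
move=> cf; have [ab|ba] := leP a b; last first.
  by exists 0 => // t /andP[at_ tb]; move: (le_trans at_ tb); rewrite leNgt ba.
have [|c _ fc] := @EVT_max R (fun t => `|f t|) a b ab.
  by apply: continuous_subspaceT => t; apply: cvg_norm; exact: cf.
by exists `|f c| => // t tab; apply: fc; rewrite in_itv.
Qed.

Lemma max_delay_ge0 (R : realType) (m : nat) (h : 'I_m.+1 -> R) : 0 <= max_delay h.
Proof. exact: bigmax_ge_id. Qed.

Lemma max_delay_ge (R : realType) (m : nat) (h : 'I_m.+1 -> R) k :
  h ord0 = 0 -> h k <= max_delay h.
Proof.
move=> h0; have [->|k0] := eqVneq k ord0; first by rewrite h0 max_delay_ge0.
exact: (le_bigmax_cond _ (P := fun k => k != ord0)).
Qed.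

Lemma lipschitz_absolutely_continuous (R : realType) (n : nat) (a b L : R)
    (f : R -> 'cV[R]_n) :
  (forall s t, a <= s -> s <= t -> t <= b -> enorm (f t - f s) <= L * (t - s)) ->
  absolutely_continuous a b f.
Proof.
(* The sign of L is not known, hence the absolute value; adding 1 keeps the denominator positive. *)
move=> fL e e0; exists (e / (`|L| + 1)); first by rewrite divr_gt0// ltr_wpDl.
move=> k u v uv _; rewrite ltr_pdivlMr ?ltr_wpDl// => uve.
apply: le_lt_trans uve; rewrite mulr_suml; apply: ler_sum => i _.
have [ui [uvi vi]] := uv i; apply: (le_trans (fL _ _ ui uvi vi)).
rewrite mulrC ler_wpM2l ?subr_ge0// (le_trans (ler_norm _))// lerDl//.
Qed.

Lemma ae_off_seq (R : realType) (S : seq R) (P : R -> Prop) :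
  (forall t, t \notin S -> P t) -> {ae (@lebesgue_measure R), forall t, P t}.
Proof.
have cS : countable [set` S] by exact: finite_set_countable (finite_seq S).
move=> SP; exists [set` S]; split.
- exact: countable_measurable.
- exact: countable_lebesgue_measure0.
- move=> t /= nP; apply: contrapT => /negP tS; exact/nP/SP.
Qed.

Section Decay.
Variables (R : realType) (n m : nat) (A : 'I_m.+1 -> 'M[R]_n).
Variables (h : 'I_m.+1 -> R) (W : 'M[R]_n) (U : R -> 'M[R]_n).
Hypothesis h_ge0 : forall k, 0 <= h k.
Hypothesis W_posdef : posdef W.
Hypothesis U_lyap : is_delay_lyapunov_matrix A h W U.
Local Notation X := (fund A h W U).
Local Notation X' := (fund_ext A h W U).

Lemma fund_bounded (T : R) : exists2 C : R, 0 <= C & forall t, t <= T -> `|X t| <= C.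
Proof.
have [C C0 XC] := continuous_bounded_itv 0 T (fund_ext_continuous (W := W) U_lyap).
exists C => // t tT; have [t0|t0] := leP 0 t; last by rewrite fund_lt0// normr0.
by rewrite fund_ge0// XC// t0 tT.
Qed.

Lemma fund_col_derive (v : 'cV[R]_n) (t : R) : 0 < t -> t \notin codom h ->
  is_derive t 1 (fun t => X' t *m v) (\sum_j A j *m (X (t - h j) *m v)).
Proof.
move=> t0 th.
have := is_derive_mulmxr v (fund_derive_l h_ge0 W_posdef U_lyap t0 th).
rewrite mulmx_suml; under eq_bigr do rewrite -mulmxA; exact.
Qed.

Lemma fund_col_continuous (v : 'cV[R]_n) : continuous (fun t => X' t *m v).
Proof. exact/continuous_mulmxr/fund_ext_continuous. Qed.

(** This brings the vectors X(t) v within reach of the stability hypothesis. The initial function is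
    the solution itself: 0 before time 0 and v at 0. Absolute continuity comes from a Lipschitz
    bound, read off the left equation. *)
Lemma fund_solution (v : 'cV[R]_n) :
  is_solution A h (fun t => X t *m v) (fun t => X t *m v).
Proof.
split=> //.
- apply: (@subspace_eq_continuous _ _ _ (fun t => X' t *m v)).
    move=> t; rewrite inE /= in_itv /= andbT => t0.
    by rewrite /from_subspace fund_ge0.
  exact/continuous_subspaceT/fund_col_continuous.
- move=> T T0; have [C C0 XC] := fund_bounded T.
  (* A bound of the right-hand side of the equation on [0, T], where |X| <= C. *)
  pose L := \sum_j n%:R * (`|A j| * (n%:R * (C * `|v|))).
  have L0 : 0 <= L by apply: sumr_ge0 => j _; rewrite !mulr_ge0.
  apply: (@lipschitz_absolutely_continuous _ _ _ _ (n%:R * L)) => s t s0 st tT.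
  rewrite (le_trans (enorm_le _))// -mulrA ler_wpM2l//.
  have t0 := le_trans s0 st; rewrite !fund_ge0//.
  apply: mx_norm_le => [|i j]; first by rewrite mulr_ge0// subr_ge0.
  rewrite [X in `|X|](_ : _ = (X' t *m v) i j - (X' s *m v) i j); last by rewrite !mxE.
  apply: (@derive_bounded R (codom h) (fun t => (X' t *m v) i j)) => //.
    by have /continuous_mxP := @fund_col_continuous v; apply.
  move=> u /andP[su ut] uh.
  have u0 := le_lt_trans s0 su.
  exists ((\sum_j A j *m (X (u - h j) *m v)) i j); last first.
    by have /is_derive_mxP := fund_col_derive v u0 uh; apply.
  rewrite (le_trans (mx_entry_le _ _ _))// (le_trans (ler_norm_sum _ _ _))//.
  apply: ler_sum => k _; rewrite (le_trans (mx_norm_mul _ _))// ler_wpM2l//.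
  rewrite ler_wpM2l// (le_trans (mx_norm_mul _ _))// ler_wpM2l// ler_wpM2r//.
  by rewrite XC// lerBlDr ler_wpDr// (le_trans (ltW ut)).
(* The point 0 is excluded since X jumps there, the delays since X' may have a corner. *)
- apply: (@ae_off_seq _ (0 :: codom h)) => t; rewrite in_cons negb_or.
  move=> /andP[t_neq0 th] t0.
  have {t_neq0}t0 : 0 < t by rewrite lt_neqAle eq_sym t_neq0.
  have Xeq : \near t, X' t *m v = X t *m v.
    near=> u; rewrite fund_ge0//; apply: ltW; near: u; exact: lt_nbhsr.
  exact: (near_eq_is_derive Xeq (fund_col_derive v t0 th)).
Unshelve. all: by end_near. Qed.

(** Every limit demanded is taken through negative times, where the function is 0; the value v at
    the end point 0 does not enter into them. *)
Lemma fund_piecewise_continuous (v : 'cV[R]_n) (a : R) :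
  piecewise_continuous a 0 (fun t => X t *m v).
Proof.
split.
- exists [::] => t /andP[_ t0] _.
  have Xeq : \near t, 0 = X t *m v.
    near=> u; rewrite fund_lt0 ?mul0mx//.
    near: u; exact: lt_nbhsl.
  rewrite /prop_for /continuous_at fund_lt0// mul0mx.
  apply: cvg_trans (near_eq_cvg Xeq) _; exact: cvg_cst.
- move=> t /andP[_ t0].
  have Xeq : \forall u \near t^'+, 0 = X u *m v.
    by near=> u; rewrite fund_lt0 ?mul0mx//.
  by apply/cvg_ex; exists 0; apply: cvg_trans (near_eq_cvg Xeq) _; exact: cvg_cst.
- move=> t /andP[_ t0].
  have Xeq : \forall u \near t^'-, 0 = X u *m v.
    by near=> u; rewrite fund_lt0 ?mul0mx// (@lt_le_trans _ _ t)//.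
  by apply/cvg_ex; exists 0; apply: cvg_trans (near_eq_cvg Xeq) _; exact: cvg_cst.
Unshelve. all: by end_near. Qed.

(** The initial function takes no values other than 0 and v, so its supremum norm is at most that of
    v. The factor n comes from comparing the Euclidean norm with the sup norm. *)
Lemma fund_decay : exponentially_stable A h ->
  exists gamma sigma : R, [/\ 0 <= gamma, 0 < sigma &
    forall t (v : 'cV[R]_n), `|X t *m v| <= gamma * expR (- sigma * t) * `|v|].
Proof.
move=> [gamma [sigma [gamma1 sigma0 stab]]].
have gamma0 : 0 <= gamma by exact: le_trans gamma1.
exists (gamma * n%:R), sigma; split => // [|t v]; first by rewrite mulr_ge0.
have [t0|t0] := leP 0 t; last first.
  by rewrite fund_lt0// mul0mx normr0 !mulr_ge0// expR_ge0.
apply: (le_trans (norm_le_enorm _)).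
apply: (le_trans (stab _ _ (fund_piecewise_continuous v _) (fund_solution v) t t0)).
have -> : gamma * n%:R * expR (- sigma * t) * `|v| =
  gamma * expR (- sigma * t) * (n%:R * `|v|) by ring.
rewrite ler_wpM2l ?mulr_ge0 ?expR_ge0//.
apply: le_trans (enorm_le v); apply: ge_sup.
  by exists (enorm (X 0 *m v)); exists 0 => //=;
    rewrite in_itv /= lexx oppr_le0 max_delay_ge0.
move=> _ [s /= + <-]; rewrite in_itv /= => /andP[_]; rewrite le_eqVlt => /predU1P[->|s0].
  by rewrite fund_ge0// (fund_ext0 W_posdef U_lyap) mul1mx.
rewrite fund_lt0// mul0mx /enorm big1 ?sqrtr0 ?sqrtr_ge0// => i _.
by rewrite mxE expr0n.
Qed.

End Decay.

(** * The scalar product *)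

Section Dot.
Variables (R : realType) (n : nat).
Implicit Types u v w : 'cV[R]_n.

Definition dot u v : R := (u^T *m v) ord0 ord0.

Lemma dotDr u v w : dot u (v + w) = dot u v + dot u w.
Proof. by rewrite /dot mulmxDr mxE. Qed.

Lemma dotNr u v : dot u (- v) = - dot u v.
Proof. by rewrite /dot mulmxN mxE. Qed.

Lemma dot0l v : dot 0 v = 0.
Proof. by rewrite /dot trmx0 mul0mx mxE. Qed.

Lemma dot_suml (k : nat) (F : 'I_k -> 'cV[R]_n) v :
  dot (\sum_i F i) v = \sum_i dot (F i) v.
Proof. by rewrite /dot linear_sum mulmx_suml summxE. Qed.

Lemma dot_sumr (k : nat) (F : 'I_k -> 'cV[R]_n) u :
  dot u (\sum_i F i) = \sum_i dot u (F i).
Proof. by rewrite /dot mulmx_sumr summxE. Qed.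

Lemma dot_mulmxl (M : 'M[R]_n) u v : dot (M *m u) v = dot u (M^T *m v).
Proof. by rewrite /dot trmx_mul mulmxA. Qed.

Lemma dot_norm u v : `|dot u v| <= n%:R * (`|u| * `|v|).
Proof.
apply: le_trans (mx_entry_le _ _ _) _; rewrite -(mx_norm_tr u).
exact: mx_norm_mul.
Qed.

Lemma dot_continuous (T : topologicalType) (f g : T -> 'cV[R]_n) :
  continuous f -> continuous g -> continuous (fun t => dot (f t) (g t)).
Proof.
move=> cf cg.
have /continuous_mxP : continuous (fun t => (f t)^T *m g t).
  by apply: continuous_mulmx => //; exact: continuous_trmx.
by apply.
Qed.

Lemma is_derive_dot (f g : R -> 'cV[R]_n) (t : R) df dg :
  is_derive t 1 f df -> is_derive t 1 g dg ->
  is_derive t 1 (fun t => dot (f t) (g t)) (dot df (g t) + dot (f t) dg).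
Proof.
move=> Df Dg; have /is_derive_mxP := is_derive_mulmx (is_derive_trmx Df) Dg.
by move=> /(_ ord0 ord0); rewrite mxE.
Qed.

End Dot.

(** * The bilinear functional pairing a solution with an adjoint one *)

Section Pairing.
Variables (R : realType) (n m : nat) (A : 'I_m -> 'M[R]_n) (h : 'I_m -> R).
Variable H : R.
Hypothesis H_ge0 : 0 <= H.
Hypothesis h_itv : forall k, 0 <= h k <= H.

Definition causal (y : R -> 'cV[R]_n) t := if 0 <= t then y t else 0.

(** The first summand bounds the scalar product, the others the integrals over intervals of length
    [h j]; in each of those, one factor n comes from the scalar product and one from the matrix
    product. *)
Definition pairing_cst : R := n%:R + \sum_j n%:R * (n%:R * `|A j|) * h j.

(* Z is the variation of <y, w> + \sum_k \int_(s - h k)^s <y, A_k^T w(. + h k)>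
   from the value taken just after the jump of the solution at 0; the jump is
   removed from Z and reappears as dot (y 0) (w 0) in the last clause. *)
Lemma pairing (y w : R -> 'cV[R]_n) :
  continuous y -> continuous w ->
  (forall t : R, 0 < t -> t \notin codom h ->
     is_derive t 1 y (\sum_j A j *m causal y (t - h j))) ->
  exists Z : R -> R, [/\ continuous Z, forall s, s <= 0 -> Z s = 0,
    forall (s : R) f, 0 < s -> s \notin codom h ->
      is_derive s 1 w (- f - \sum_j (A j)^T *m w (s + h j)) ->
      is_derive s 1 Z (- dot (y s) f) &
    forall T kappa C : R, 0 <= T -> 0 <= kappa -> 0 <= C ->
      (forall s, T - H <= s <= T -> `|causal y s| <= kappa) ->
      (forall s, T <= s <= T + H -> `|w s| <= C) ->
      `|Z T + dot (y 0) (w 0)| <= pairing_cst * (kappa * C)].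
Proof.
move=> cy cw Dy.
have h_ge0 k : 0 <= h k by have /andP[] := h_itv k.
pose p k s := dot (y s) ((A k)^T *m w (s + h k)).
have cp k : continuous (p k).
  apply: dot_continuous => //; apply: continuous_mulmxl.
  by apply: (@continuous_compf _ _ _ (fun s => s + h k)) => //; exact: continuous_addr.
(* Any starting point below 0 would do; -1 makes the primitive differentiable at 0 as well. *)
have primP k : exists P : R -> R, forall x : R, -1 < x -> is_derive x 1 P (p k x).
  exact: continuous_primitive.
pose P k := sval (cid (primP k)).
have DP k (x : R) : -1 < x -> is_derive x 1 (P k) (p k x).
  by rewrite /P; case: cid => /= ?; apply.
(* Freezing the primitive at negative times makes Q(s) - Q(s - h_k) the integral over the
   nonnegative part of [s - h_k, s], in agreement with [causal]. *)
pose Q k s := P k (Num.max s 0).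
have cQ k : continuous (Q k).
  move=> s; have DPs : is_derive (Num.max s 0) 1 (P k) (p k (Num.max s 0)).
    by apply: DP; rewrite lt_max ltrN10 orbT.
  have cPs : {for Num.max s 0, continuous (P k)}.
    by apply/differentiable_continuous/derivable1_diffP; case: DPs.
  exact: (continuous_comp (continuous_max0 (x := s)) cPs).
have DQ_gt0 k (s : R) : 0 < s -> is_derive s 1 (Q k) (p k s).
  move=> s0; have Qeq : \near s, P k s = Q k s.
    near=> u; rewrite /Q max_l// ltW//; near: u; exact: lt_nbhsr.
  by apply: (near_eq_is_derive Qeq); apply: DP; rewrite (lt_trans _ s0)// ltrN10.
have DQ_lt0 k (s : R) : s < 0 -> is_derive s 1 (Q k) 0.
  move=> s0; have Qeq : \near s, cst (P k 0) s = Q k s.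
    near=> u; rewrite /Q max_r// ltW//; near: u; exact: lt_nbhsl.
  by apply: (near_eq_is_derive Qeq); exact: is_derive_cst.
pose g s := dot (y s) (w s).
have cg : continuous g by exact: dot_continuous.
pose Z s := g (Num.max s 0) - g 0 + \sum_k (Q k s - Q k (s - h k)).
exists Z; split.
- apply: continuous_addf.
    apply: continuous_addf; last by move=> x; exact: cvg_cst.
    by apply: continuous_compf => //; exact: continuous_max0.
  apply: continuous_sumf => k; apply: continuous_addf => //.
  apply: continuous_oppf.
  by apply: (@continuous_compf _ _ _ (fun s => s - h k)) => //; exact: continuous_addr.
- move=> s s0; rewrite /Z max_r// subrr add0r; apply: big1 => k _.
  by rewrite /Q !max_r ?subrr// subr_le0 (le_trans s0).
- move=> s f s0 sh Dw.
  have geq : \near s, g s = g (Num.max s 0).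
    near=> u; rewrite max_l// ltW//; near: u; exact: lt_nbhsr.
  have Dg := near_eq_is_derive geq (is_derive_dot (Dy s s0 sh) Dw).
  have DZ1 := is_deriveB Dg (is_derive_cst (g 0) s (1 : R)).
  have DZ2 k : is_derive s 1 (fun s => Q k s - Q k (s - h k))
      (p k s - dot (causal y (s - h k)) ((A k)^T *m w s)).
    apply: is_deriveB; first exact: DQ_gt0.
    apply: (is_derive_shiftD (f := Q k) (c := - h k)).
    have [hs|sh'] := leP (h k) s; rewrite /causal subr_ge0.
      rewrite hs.
      have {}hs : h k < s.
        by rewrite lt_neqAle hs andbT; apply: contraNneq sh => <-; exact: codom_f.
      by have := DQ_gt0 k (s - h k); rewrite subr_gt0 /p subrK; apply.
    by rewrite leNgt sh' dot0l; apply: DQ_lt0; rewrite subr_lt0.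
  apply: (is_derive_eq (is_deriveD DZ1 (is_derive_sumf DZ2))).
  (* The lower end of each integral cancels a delayed term of y', the upper end an advanced term of
     w'; only the product of y and f survives. *)
  rewrite dot_suml sumrB !(dotDr, dotNr) dot_sumr subr0.
  under eq_bigr do rewrite dot_mulmxl.
  rewrite /p; ring.
- move=> T kappa C T0 kappa0 C0 yk wC.
  have -> : Z T + dot (y 0) (w 0) = g T + \sum_k (Q k T - Q k (T - h k)).
    by rewrite /Z max_l// /g; ring.
  rewrite (le_trans (ler_normD _ _))// /pairing_cst mulrDl lerD//.
    rewrite (le_trans (dot_norm _ _))// ler_wpM2l//.
    rewrite ler_pM//; last by rewrite wC// lexx lerDl.
    by have := yk T; rewrite /causal T0; apply; rewrite lexx gerDl oppr_le0 H_ge0.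
  rewrite mulr_suml (le_trans (ler_norm_sum _ _ _))//; apply: ler_sum => k _.
  have /andP[hk0 hkH] := h_itv k.
  have -> : n%:R * (n%:R * `|A k|) * h k * (kappa * C) =
    n%:R * (kappa * (n%:R * (`|A k| * C))) * (T - (T - h k)) by ring.
  apply: (@derive_bounded R [:: 0] (Q k)) => //; first by rewrite gerDl oppr_le0.
  move=> s /andP[hs sT]; rewrite inE neq_lt => /orP[s0|s0].
    by exists 0; [rewrite normr0 !mulr_ge0|exact: DQ_lt0].
  exists (p k s); last exact: DQ_gt0.
  rewrite (le_trans (dot_norm _ _))// ler_wpM2l// ler_pM//.
    have := yk s; rewrite /causal (ltW s0); apply.
    by rewrite (ltW sT) andbT (le_trans _ (ltW hs))// lerD2l lerN2.
  rewrite (le_trans (mx_norm_mul _ _))// ler_wpM2l// mx_norm_tr ler_wpM2l//.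
  apply: wC; rewrite -lerBlDr (ltW hs)/= lerD// ltW//.
Unshelve. all: by end_near. Qed.

End Pairing.

(** * Boundedness of the Lyapunov matrix *)

Section LyapunovBounded.
Variables (R : realType) (n m : nat) (A : 'I_m.+1 -> 'M[R]_n).
Variables (h : 'I_m.+1 -> R) (W : 'M[R]_n) (U : R -> 'M[R]_n).
Hypothesis h0 : h ord0 = 0.
Hypothesis h_ge0 : forall k, 0 <= h k.
Hypothesis W_posdef : posdef W.
Hypothesis U_lyap : is_delay_lyapunov_matrix A h W U.
Local Notation X := (fund A h W U).
Local Notation X' := (fund_ext A h W U).
Local Notation H := (max_delay h).

Lemma causal_fund (v : 'cV[R]_n) t : causal (fun t => X' t *m v) t = X t *m v.
Proof. by rewrite /causal /fund; case: ifP => // _; rewrite mul0mx. Qed.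

Lemma fund_pairing (v : 'cV[R]_n) (w : R -> 'cV[R]_n) : continuous w ->
  exists Z : R -> R, [/\ continuous Z, forall s, s <= 0 -> Z s = 0,
    forall (s : R) f, 0 < s -> s \notin codom h ->
      is_derive s 1 w (- f - \sum_j (A j)^T *m w (s + h j)) ->
      is_derive s 1 Z (- dot (X s *m v) f) &
    forall T kappa C : R, 0 <= T -> 0 <= kappa -> 0 <= C ->
      (forall s, T - H <= s <= T -> `|X s *m v| <= kappa) ->
      (forall s, T <= s <= T + H -> `|w s| <= C) ->
      `|Z T + dot v (w 0)| <= pairing_cst A h * (kappa * C)].
Proof.
move=> cw.
have h_itv k : 0 <= h k <= H by rewrite h_ge0 max_delay_ge.
have [||Z [cZ Z0 DZ bZ]] :=
  @pairing _ _ _ A h H (max_delay_ge0 h) h_itv (fun t => X' t *m v) w _ cw.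
- exact: fund_col_continuous.
- move=> t t0 th; under eq_bigr do rewrite causal_fund.
  exact: fund_col_derive.
exists Z; split => // [s f s0 sh Dw|T kappa C T0 kappa0 C0 Xk wC].
  by have := DZ s f s0 sh Dw; rewrite fund_ge0// ltW.
have := bZ T kappa C T0 kappa0 C0; rewrite (fund_ext0 W_posdef U_lyap) mul1mx.
by apply => // s sT; rewrite causal_fund; exact: Xk.
Qed.

(** Pair X(s) e_i with w(s) = U(s - t) e_j, which solves the homogeneous adjoint equation for s < t.
    The functional is then conserved up to time t, so the entry (i, j) of U(- t) equals its value
    there, which involves only the bounded X and the values of U on [0, H]. Positive times follow by
    transposition. *)
Lemma lyap_bounded : exponentially_stable A h ->
  exists2 C : R, 0 <= C & forall t, `|U t| <= C.
Proof.
move=> /(fund_decay h_ge0 W_posdef U_lyap) [gamma [sigma [gamma0 sigma0 decay]]].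
have [C0 C00 UC0] := continuous_bounded_itv 0 H (U_continuous U_lyap).
have delta_le1 (i : 'I_n) : `|delta_mx i ord0 : 'cV[R]_n| <= 1.
  by apply: mx_norm_le => // a b; rewrite mxE; case: (_ && _); rewrite ?normr1 ?normr0.
have U_neg t : 0 <= t -> `|U (- t)| <= `|pairing_cst A h * (gamma * (n%:R * C0))|.
  move=> t0; apply: mx_norm_le => // i j.
  pose ei : 'cV[R]_n := delta_mx i ord0; pose ej : 'cV[R]_n := delta_mx j ord0.
  have [|Z [cZ Z0 DZ bZ]] := @fund_pairing ei (fun s => U (s - t) *m ej).
    apply: continuous_mulmxr; exact: (U_shift_continuous (c := - t) U_lyap).
  have Zt : Z t = 0.
    rewrite -(Z0 0)//; apply: (derive0_cst (S := codom h)) => // s /andP[s0 st] sh.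
    (* Before time t the source term f is 0. *)
    have <- : - dot (X s *m ei) 0 = 0 by rewrite /dot mulmx0 mxE oppr0.
    apply: DZ => //.
    have := is_derive_mulmxr ej (is_derive_shiftD (c := - t)
      (U_derive_lt0 U_lyap (t := s - t) _)).
    rewrite subr_lt0 => /(_ st) D; apply: (is_derive_eq D).
    rewrite oppr0 add0r mulNmx mulmx_suml; congr (- _); apply: eq_bigr => k _.
    by rewrite mulmxA addrAC.
  have -> : U (- t) i j = dot ei (U (0 - t) *m ej).
    by rewrite /dot trmx_delta -rowE mxE -colE mxE sub0r.
  rewrite -[dot _ _]add0r -{1}Zt; apply: le_trans (ler_norm _).
  apply: bZ => //; first by rewrite mulr_ge0.
    move=> s _; have [s0|s0] := leP 0 s; last by rewrite fund_lt0// mul0mx normr0.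
    rewrite (le_trans (decay _ _))// -mulrA ler_piMr//.
    rewrite mulr_ile1 ?expR_ge0 ?delta_le1//.
    by rewrite -expR0 ler_expR mulNr oppr_le0 mulr_ge0// ltW.
  move=> s /andP[ts sT]; rewrite (le_trans (mx_norm_mul _ _))// ler_wpM2l//.
  rewrite -[leRHS]mulr1 ler_pM ?delta_le1// UC0//.
  by rewrite subr_ge0 ts lerBlDl.
exists `|pairing_cst A h * (gamma * (n%:R * C0))| => // t.
have [t0|t0] := leP 0 t; first by rewrite -mx_norm_tr -(U_tr U_lyap) U_neg.
by rewrite -(opprK t) U_neg// oppr_ge0 ltW.
Qed.

End LyapunovBounded.

(** * Positivity of the quadratic form *)

Lemma near_right_notin (R : realType) (S : seq R) (a : R) :
  \forall t \near a^'+, t \notin S.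
Proof.
elim: S => [|s S IH]; first by near=> t.
have [sa|as_] := leP s a; near=> t; rewrite in_cons negb_or; apply/andP; split.
- by rewrite gt_eqF// (le_lt_trans sa).
- by near: t.
- by rewrite lt_eqF//; near: t; exact: nbhs_right_lt.
- by near: t.
Unshelve. all: by end_near. Qed.

Section QuadraticForm.
Variables (R : realType) (n m : nat) (A : 'I_m.+1 -> 'M[R]_n).
Variables (h : 'I_m.+1 -> R) (W : 'M[R]_n) (U : R -> 'M[R]_n).
Hypothesis h0 : h ord0 = 0.
Hypothesis h_ge0 : forall k, 0 <= h k.
Hypothesis W_posdef : posdef W.
Hypothesis U_lyap : is_delay_lyapunov_matrix A h W U.
Hypothesis stable : exponentially_stable A h.
Local Notation X := (fund A h W U).
Local Notation X' := (fund_ext A h W U).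
Local Notation H := (max_delay h).
Variables (r : nat) (tau : 'I_r -> R) (g : 'I_r -> 'cV[R]_n).
Hypothesis tau_range : forall i, 0 <= tau i <= H.

Let x t := \sum_j X (t + tau j) *m g j.
Let u t := \sum_j U (t + tau j) *m g j.
(** The quadratic form \sum_(i, j) g_i^T U(tau_j - tau_i) g_j of the block matrix. *)
Let Q := \sum_i dot (g i) (u (- tau i)).

(** z is the functional of x and u with its jumps taken out: the sum over i of the pairings of X g_i
    with u(. - tau_i), each shifted by tau_i. The removed jumps add up to Q, and the full functional
    decays, so z runs from 0 at - H to - Q at infinity. *)
Lemma lyap_energy : exists z : R -> R, exists S : seq R, exists B sigma : R,
  [/\ continuous z, z (- H) = 0,
    forall t : R, t \notin S -> is_derive t 1 z (- dot (x t) (W *m x t)),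
    0 < sigma /\ 0 <= B &
    forall s, 0 <= s -> `|z (s + H) + Q| <= B * expR (- sigma * s)].
Proof.
have [gamma [sigma [gamma0 sigma0 decay]]] :=
  @fund_decay _ _ _ _ _ _ _ h_ge0 W_posdef U_lyap stable.
have [C0 C00 UC0] := lyap_bounded h0 h_ge0 W_posdef U_lyap stable.
pose C := \sum_j n%:R * (C0 * `|g j|).
have C_ge0 : 0 <= C by apply: sumr_ge0 => j _; rewrite !mulr_ge0.
have uC t : `|u t| <= C.
  rewrite (le_trans (ler_norm_sum _ _ _))//; apply: ler_sum => j _.
  by rewrite (le_trans (mx_norm_mul _ _))// ler_wpM2l// ler_wpM2r.
have cu i : continuous (fun s => u (s - tau i)).
  apply: (@continuous_compf _ _ _ (fun s => s - tau i) u); first exact: continuous_addr.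
  by apply: continuous_sumf => j; apply/continuous_mulmxr/U_shift_continuous/U_lyap.
have pairs i := fund_pairing h0 h_ge0 W_posdef U_lyap (g i) (@cu i).
have [Z ZP] := choice pairs.
have Z0 i s : s <= 0 -> Z i s = 0 by case: (ZP i) => _ + _ _; apply.
have DZ_lt0 i (s : R) : s < 0 -> is_derive s 1 (Z i) 0.
  move=> s0; have Zeq : \near s, cst 0 s = Z i s.
    near=> v; rewrite Z0// ltW//; near: v; exact: lt_nbhsl.
  by apply: (near_eq_is_derive Zeq); exact: is_derive_cst.
(* At - tau_i a new term of x sets in; at h_k - tau_i the argument t + tau_i is a delay. *)
pose S := codom (fun i => - tau i) ++
  codom (fun ik : 'I_r * 'I_m.+1 => h ik.2 - tau ik.1).
pose G := \sum_i `|g i|.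
have gG i : `|g i| <= G by rewrite /G (bigD1 i)//= lerDl sumr_ge0.
have G0 : 0 <= G by rewrite sumr_ge0.
exists (fun t => \sum_i Z i (t + tau i)), S.
exists (r%:R * (`|pairing_cst A h| * (gamma * G * C))), sigma; split.
- apply: continuous_sumf => i.
  apply: (@continuous_compf _ _ _ (fun t => t + tau i)); first exact: continuous_addr.
  by case: (ZP i).
- apply: big1 => i _; apply: Z0.
  by have /andP[_] := tau_range i; rewrite addrC subr_le0.
- move=> t tS.
  have t_tau i : t + tau i != 0.
    by rewrite addr_eq0; apply: contraNneq tS => ->; rewrite mem_cat codom_f.
  have t_h i : t + tau i \notin codom h.
    apply: contra tS => /codomP[k tk]; rewrite mem_cat; apply/orP; right.
    by apply/codomP; exists (i, k) => /=; rewrite -tk addrK.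
  have Du : is_derive t 1 u (- (W *m x t) - \sum_k (A k)^T *m u (t + h k)).
    (* The source terms of the separate summands of u add up to W x(t). *)
    have Dj j : is_derive t 1 (fun s => U (s + tau j) *m g j) _ :=
      is_derive_mulmxr (g j) (is_derive_shiftD (U_derive W_posdef U_lyap (t_tau j))).
    apply: (is_derive_eq (is_derive_sumf Dj)).
    under eq_bigr do rewrite mulmxBl mulNmx -mulmxA.
    rewrite sumrB sumrN -mulmx_sumr; congr (_ - _).
    under eq_bigr do rewrite mulmx_suml.
    rewrite exchange_big; apply: eq_bigr => k _; rewrite mulmx_sumr.
    by apply: eq_bigr => j _; rewrite mulmxA addrAC.
  have DZ i : is_derive (t + tau i) 1 (Z i) (- dot (X (t + tau i) *m g i) (W *m x t)).
    have := t_tau i; rewrite neq_lt => /orP[ti0|ti0].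
      by rewrite fund_lt0// mul0mx dot0l oppr0; exact: DZ_lt0.
    case: (ZP i) => _ _ + _; apply => //.
    have -> : - (W *m x t) - \sum_j (A j)^T *m u (t + tau i + h j - tau i) =
        - (W *m x t) - \sum_k (A k)^T *m u (t + h k).
      by congr (_ - _); apply: eq_bigr => k _; rewrite addrAC addrK.
    by apply: is_derive_shiftD; rewrite addrK.
  have Dz := is_derive_sumf (fun i => is_derive_shiftD (DZ i)).
  by apply: (is_derive_eq Dz); rewrite sumrN dot_suml.
- by split => //; rewrite !mulr_ge0.
- move=> s s0; rewrite /Q -big_split /=.
  rewrite (le_trans (ler_norm_sum _ _ _))//.
  have -> : r%:R * (`|pairing_cst A h| * (gamma * G * C)) * expR (- sigma * s) =
      \sum_(i < r) `|pairing_cst A h| * (gamma * expR (- sigma * s) * G * C).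
    by rewrite sumr_const card_ord -[RHS]mulr_natl; ring.
  apply: ler_sum => i _; have /andP[tau0 tauH] := tau_range i.
  (* The window of length H that ends at s + H + tau_i starts at s + tau_i >= s, so the decay of X
     is already worth exp(- sigma s) on all of it. *)
  case: (ZP i) => _ _ _ /(_ (s + H + tau i) (gamma * expR (- sigma * s) * G) C) bZ.
  rewrite -(add0r (- tau i)).
  apply: (@le_trans _ _ (pairing_cst A h * (gamma * expR (- sigma * s) * G * C))).
    apply: bZ => //.
    - by rewrite !addr_ge0// max_delay_ge0.
    - by rewrite !mulr_ge0// expR_ge0.
    - move=> v /andP[sv _]; rewrite (le_trans (decay _ _))//.
      rewrite ler_pM ?mulr_ge0 ?expR_ge0// ler_wpM2l// ler_expR.
      rewrite !mulNr lerN2 ler_wpM2l ?(ltW sigma0)// (le_trans _ sv)//.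
      by rewrite addrAC addrK lerDl.
  by rewrite ler_wpM2r ?ler_norm// !mulr_ge0 ?expR_ge0.
Unshelve. all: by end_near. Qed.

Hypothesis tau_incr : forall i j : 'I_r, (i < j)%N -> tau i < tau j.

Lemma lyap_quadratic_gt0 : (exists i, g i != 0) -> 0 < Q.
Proof.
move=> [i1 gi1]; have [z [S [B [sigma [cz zH Dz [sigma0 B0] zlim]]]]] := lyap_energy.
(* The last index with a nonzero vector, that is, the earliest time - tau_i at which x becomes
   nonzero. *)
have [i0 gi0 imax] : exists2 i0, g i0 != 0 & forall j : 'I_r, (i0 < j)%N -> g j = 0.
  case: (@arg_maxnP _ i1 (fun i => g i != 0) (@nat_of_ord r) gi1) => i gi imax.
  exists i => // j ij; apply/eqP; apply: contraLR ij => /imax.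
  by rewrite -leqNgt.
have z_decr a b : a <= b -> z b <= z a.
  move=> ab; apply: (derive_le0_decr (S := S)) => // t _ tS.
  exists (- dot (x t) (W *m x t)); last exact: Dz.
  have [->|xt] := eqVneq (x t) 0; first by rewrite dot0l oppr0.
  by rewrite oppr_le0 ltW// /dot mulmxA; case: W_posdef => _; apply.
pose t0 := - tau i0.
(* Just after - tau_i0, the terms with smaller index still have negative argument and those with
   larger index have g_j = 0. What remains is X'(t + tau_i0) g_i0, which tends to g_i0. *)
have near_t0 : \forall t \near t0^'+, x t != 0 /\ t \notin S.
  have cX : continuous (fun t => `|X' (t + tau i0) *m g i0|).
    suff cX' : continuous (fun t => X' (t + tau i0) *m g i0).
      by move=> t; apply: cvg_norm; exact: cX'.
    apply/continuous_mulmxr/(@continuous_compf _ _ _ (fun t => t + tau i0)).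
      exact: continuous_addr.
    exact: (fund_ext_continuous U_lyap).
  have tau_near : \forall t \near t0^'+,
      forall j : 'I_r, (j < i0)%N -> t + tau j < 0.
    apply: filter_forall => j; have [ji|_] := ltnP j i0; last by near=> t.
    near=> t => _; rewrite -ltrBrDr sub0r; near: t; apply: nbhs_right_lt.
    by rewrite ltrN2 tau_incr.
  near=> t; split; last by near: t; exact: near_right_notin.
  have t0t : t0 < t by near: t; exact: nbhs_right_gt.
  have tneg : forall j : 'I_r, (j < i0)%N -> t + tau j < 0 by near: t.
  rewrite /x (bigD1 i0)//= [X in _ + X]big1 ?addr0 => [|j ji]; last first.
    have [{}ji|ij|/val_inj ij] := ltngtP j i0; last by rewrite ij eqxx in ji.
      by rewrite fund_lt0 ?mul0mx// tneg.
    by rewrite imax ?mulmx0.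
  rewrite fund_ge0 -?lerBlDr ?sub0r ?ltW// -normr_gt0.
  near: t; apply: cvg_within; apply: (cvgr_gt _ (cX t0)).
  by rewrite addNr (fund_ext0 W_posdef U_lyap) mul1mx normr_gt0.
have [d d0 dP] : exists2 d, 0 < d & forall t, t0 < t < t0 + d -> x t != 0 /\ t \notin S.
  have [/= d d0 dP] := near_t0; exists d => // t /andP[t0t td].
  by apply: dP => //=; rewrite distrC ger0_norm ?subr_ge0 ?ltW// ltrBlDl.
pose t1 := t0 + d / 2.
have t01 : t0 < t1 by rewrite ltrDl divr_gt0.
(* On (t0, t1) the derivative of z is strictly negative, and z(t0) <= z(- H) = 0. *)
have z1 : z t1 < 0.
  have [||c] := @MVT R z (fun t => - dot (x t) (W *m x t)) t0 t1 t01.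
  - move=> t; rewrite in_itv /= => /andP[t0t tt1]; apply: Dz.
    apply: (dP t _).2; rewrite t0t (lt_trans tt1)// ltrD2l.
    by rewrite gtr_pMr// invf_lt1// ltr1n.
  - exact: continuous_subspaceT.
  rewrite in_itv /= => /andP[t0c ct1] E.
  have xc : x c != 0.
    apply: (dP c _).1; rewrite t0c (lt_trans ct1)// ltrD2l.
    by rewrite gtr_pMr// invf_lt1// ltr1n.
  apply: (@lt_le_trans _ _ (z t0)); last first.
    rewrite -zH z_decr// lerN2; by have /andP[] := tau_range i0.
  rewrite -subr_lt0 E nmulr_rlt0 ?subr_gt0// oppr_lt0 /dot mulmxA.
  by case: W_posdef => _; apply.
(* If Q <= 0, then z + Q stays below z(t1) < 0 after t1, which contradicts its convergence to 0. *)
rewrite ltNge; apply/negP => Q0.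
(* The first entry puts s + H beyond t1; the last one makes B exp(- sigma s) smaller than - z(t1),
   through exp(y) >= 1 + y. *)
pose s := Num.max (t1 - H) (Num.max 0 (B / (- z t1 * sigma))).
have s_ge0 : 0 <= s by rewrite !le_max lexx orbT.
have := zlim s s_ge0; apply/negP; rewrite -ltNge.
have zs : z (s + H) <= z t1 by rewrite z_decr// -lerBlDr le_max lexx.
have BE : B * expR (- sigma * s) < - z t1.
  have e0 := expR_gt0 (sigma * s).
  rewrite mulNr expRN ltr_pdivrMr//.
  have : B / (- z t1 * sigma) <= s by rewrite !le_max lexx !orbT.
  rewrite ler_pdivrMr ?mulr_gt0 ?oppr_gt0// => Bs.
  apply: (@lt_le_trans _ _ (- z t1 * (1 + sigma * s))).
    apply: le_lt_trans Bs _; rewrite mulrDr mulr1.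
    have -> : s * (- z t1 * sigma) = - z t1 * (sigma * s) by ring.
    by rewrite ltrDr oppr_gt0.
  by rewrite ler_wpM2l ?expR_ge1Dx// oppr_ge0 ltW.
apply: (lt_le_trans BE); rewrite ler0_norm; lra.
Unshelve. all: by end_near. Qed.

End QuadraticForm.

(** * From the quadratic form to the block matrix *)

Unset Implicit Arguments.

Theorem theorem3 (R : realType) (n m : nat) (A : 'I_m.+1 -> 'M[R]_n)
    (h : 'I_m.+1 -> R) (W : 'M[R]_n) (U : R -> 'M[R]_n)
    (h0 : h ord0 = 0)
    (h_gt0 : forall k : 'I_m.+1, k != ord0 -> 0 < h k)
    (A_neq0 : exists2 k : 'I_m.+1, k != ord0 & A k != 0)
    (W_posdef : posdef W)
    (stable : exponentially_stable A h)
    (U_lyap : is_delay_lyapunov_matrix A h W U)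
    (r : nat) (tau : 'I_r -> R)
    (tau_incr : forall i j : 'I_r, (i < j)%N -> tau i < tau j)
    (tau_range : forall i : 'I_r, 0 <= tau i <= max_delay h) :
  posdef (\mxblock_(i < r, j < r) U (tau j - tau i)).

Proof.
have h_ge0 k : 0 <= h k.
  by have [->|/h_gt0/ltW//] := eqVneq k ord0; rewrite h0.
split.
  rewrite tr_mxblock; apply: eq_mxblock => i j.
  by rewrite -(U_tr U_lyap) opprB.
move=> v v0; pose g i := submxcol v i.
have g_neq0 : exists i, g i != 0.
  apply: contrapT => /forallNP gi0; case/negP: v0; apply/eqP/mxcolP => i.
  have -> : submxcol (0 : 'cV[R]_(\sum_(i < r) n)) i = 0.
    by apply/matrixP => a b; rewrite !mxE.
  by apply/eqP/negPn/negP; exact: gi0.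
have := lyap_quadratic_gt0 h0 h_ge0 W_posdef U_lyap stable tau_range tau_incr g_neq0.
(* Cutting v into its blocks g_i turns the block product into the double sum defining the quadratic
   form. *)
congr (0 < _); rewrite -[in RHS](submxcolK v) tr_mxcol mul_mxrow_mxblock.
rewrite mul_mxrow_mxcol summxE; under [RHS]eq_bigr do rewrite mulmx_suml summxE.
rewrite exchange_big; apply: eq_bigr => i _; rewrite dot_sumr.
by apply: eq_bigr => j _; rewrite /dot mulmxA addrC.
Qed.
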